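(* Let $F,G:\mathbb{Z}_{\ge 1}\to\mathbb{Z}_{\ge 1}$ be the functions defined in the context. Then: (1) For every $m\ge 1$, $G(m)\le F(m)$, with equality if and only if $m\in\{1,2,3,4,5,15,16\}$. (2) $\lim_{m\to\infty}\frac{F(m)}{G(m)}=\infty$.
   Context: The function $G$. For integers $d\ge 3$, $k\ge 1$ let $\vartheta(d,k)=k+\left\lceil\frac{1}{k+1}\left(\binom{k+d+1}{d}-(k+2)\right)\right\rceil$. Write $\dim\mathcal{M}(2,\dots,d;r)=\binom{r+d+1}{d}-(r+1)^2-(r+d)$ (the dimension of the coarse moduli space of semi-stable intersections of hypersurfaces of degrees $2,3,\dots,d$ in $\mathbb{P}^r_{\mathbb{C}}$). For $d\ge 4$, $k\ge 1$ set $$\varphi(d,k)=\max\left\{\frac{(d+k)!}{d!},\ \dim\mathcal{M}(2,\dots,d;\vartheta(d,k))+d+k+1\right\}.$$ Define $G(1),\dots,G(14)$ to be, in order, $2,\ 3,\ 4,\ 5,\ 9,\ 21,\ 109,\ 325,\ 1681,\ 15121,\ 151201,\ 1663201,\ 19958401,\ 259459201$, and for $m\ge 15$ set $G(m)=1+\min\{\varphi(d,m-d-1) : 4\le d\le m-2\}$. The function $F$ (Wolfson's function). For $d\ge 2$, $k\ge 1$ set $\psi(d,k)_0=k$ and, for $0\le i<d-2$, $$\psi(d,k)_{i+1}=\psi(d,k)_i+\left\lceil\frac{1}{\psi(d,k)_i+1}\binom{\psi(d,k)_i+d-i}{d-i}\right\rceil .$$ Let $\dim\mathcal{M}(3;r)=\binom{r+3}{3}-(r+1)^2$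 (dimension of the coarse moduli space of semi-stable cubic hypersurfaces in $\mathbb{P}^r_{\mathbb{C}}$) and $$\Phi(d,k)=\max\left\{\frac{(d+k)!}{d!},\ \dim\mathcal{M}(3;\psi(d,k)_{d-2})+d+k+1\right\}.$$ For $m\le 3$ set $F(m)=m+1$, and for $m\ge 4$ set $F(m)=2\left\lfloor\frac12\min_{2\le d\le m-2}\Phi(d,m-d-1)\right\rfloor+1$. *)

(* Defs.v *)
From Stdlib Require Import BinNat.
From mathcomp Require Import all_boot all_order all_algebra.

Set Implicit Arguments.
Unset Strict Implicit.
Unset Printing Implicit Defensive.

Import Order.TTheory GRing.Theory Num.Theory.

Local Open Scope ring_scope.

(* The ceiling as a natural number; it is only applied below to nonnegative
   arguments (when d >= 1 in vartheta), where the absolute value is harmless. *)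
Definition ceiln (x : rat) : nat := `|Num.ceil x|%N.

(* dimM_intersection d r and dimM_cubic r are the dimensions of the coarse
   moduli spaces of semi-stable intersections of hypersurfaces of degrees
   2, 3, ..., d in P^r, resp. of semi-stable cubic hypersurfaces in P^r.  They
   are integers, so that the subtractions are not truncated. *)

Definition vartheta (d k : nat) : nat :=
  (k + ceiln (('C(k + d + 1, d)%:R - (k + 2)%:R) / (k + 1)%:R))%N.

Definition dimM_intersection (d r : nat) : int :=
  ('C(r + d + 1, d))%:Z - ((r + 1) ^ 2)%N%:Z - (r + d)%N%:Z.

Definition phi (d k : nat) : int :=
  Num.max (((d + k)`! %/ d`!)%N%:Z)
          (dimM_intersection d (vartheta d k) + (d + k + 1)%N%:Z).

(* G 1, ..., G 14, in binary since the last ones are too large for unary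
   numerals. *)
Definition G_init : seq N :=
  [:: 2; 3; 4; 5; 9; 21; 109; 325; 1681; 15121; 151201; 1663201;
      19958401; 259459201]%num.

(* The minima in G and F range over nonempty sets of indices, d = 4 and d = 2
   being the first ones; these terms also serve as initial values of the
   iterated minimum.  The values at m = 0 are irrelevant. *)
Definition G (m : nat) : int :=
  if (m <= 14)%N then (nat_of_bin (nth 0%num G_init m.-1))%:Z
  else 1 + \big[Num.min/phi 4 (m - 4 - 1)]_(4 <= d < (m - 2).+1)
             phi d (m - d - 1).

Fixpoint psi (d k i : nat) : nat :=
  if i is j.+1 then
    let p := psi d k j in
    (p + ceiln ((p + 1)%:R^-1 * 'C(p + d - j, d - j)%:R))%N
  else k.

Definition dimM_cubic (r : nat) : int :=
  ('C(r + 3, 3))%:Z - ((r + 1) ^ 2)%N%:Z.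

Definition Phi (d k : nat) : int :=
  Num.max (((d + k)`! %/ d`!)%N%:Z)
          (dimM_cubic (psi d k (d - 2)) + (d + k + 1)%N%:Z).

Definition F (m : nat) : int :=
  if (m <= 3)%N then (m + 1)%N%:Z
  else
    2 * Num.floor
          ((\big[Num.min/Phi 2 (m - 2 - 1)]_(2 <= d < (m - 2).+1)
              Phi d (m - d - 1))%:~R / 2 : rat)
    + 1.

(* Main.v *)
From Stdlib Require Import BinNat.
Require Import Defs.
From mathcomp Require Import all_boot all_order all_algebra.
From mathcomp Require Import all_classical all_reals all_analysis.
From mathcomp Require Import zify ring.

(** Put m - 1 = d + k. Both Phi d k and phi d k are the maximum of the same factorial
    term (m - 1)! / d!, which decreases when d grows, and of a geometric term, which
    forbids large d. The geometric term of F comes from iterating psi, where each step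
    raises to a power of order d, then d - 1, and so on; that of G comes from the single
    step vartheta. Hence G can afford a larger d than F, and the smaller factorial wins.

    Quantitatively, when d >= 5, k >= 2 and m >= 17, the geometric term of Phi d k is at
    least d + 1 times that of phi d.+1 k.-1 ([cubic_ge_intersection]), so that
    Phi d k >= (d + 1) * phi d.+1 k.-1 ([Phi_ge_phiS]). At the end of the range, k = 1,
    Phi is at least (m - 1)! ([fact_le_cubic]). For d < D the factorial term gives
    Phi d k >= (m - 1)! / (D - 1)!. Together ([G_F_gap]), for D >= 5: if c <= D and
    c * phi D (m - D - 1) <= (m - 1)! / (D - 1)!, then c * (G m - 1) <= F m.

    For fixed D the geometric term of phi D (m - D - 1) is polynomial in m, so the
    condition holds with c = D for all large m; as D is arbitrary, F / G tends to
    infinity. With c = 2 and D = 5 the condition holds for every m >= 17, which gives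
    G m < F m there. The values m <= 16 are computed in binary arithmetic; as the
    iterates of psi are huge, a lower bound for Phi uses the first iterate that is
    large enough. *)

Set Implicit Arguments.
Unset Strict Implicit.
Unset Printing Implicit Defensive.

Import Order.TTheory GRing.Theory Num.Theory.
Import numFieldNormedType.Exports.

(** * Binomial coefficients, powers and factorials *)

Lemma mul_binD a j : j.+1 * 'C(a + j.+1, j.+1) = (a + j.+1) * 'C(a + j, j).
Proof. by rewrite -mul_bin_diag addnS. Qed.

Lemma bin_addC a b : 'C(a + b, b) = 'C(a + b, a).
Proof. by rewrite -bin_sub ?leq_addl // addnK. Qed.

Lemma leq_binDr a m n : m <= n -> 'C(a + m, m) <= 'C(a + n, n).
Proof. by move=> mn; rewrite !bin_addC leq_bin2l // leq_add2l. Qed.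

Lemma bin3_mul6 n : ('C(n.+3, 3) * 6 = n.+3 * n.+2 * n.+1)%N.
Proof. by rewrite -[6%N]/(3`!)%N bin_ffact !ffactnS ffactn0 /=; lia. Qed.

Lemma bin4_mul24 n : ('C(n + 4, 4) * 24 = (n + 4) * (n + 3) * (n + 2) * (n + 1))%N.
Proof.
by rewrite -[24%N]/(4`!)%N bin_ffact !addnS !addn0 !ffactnS ffactn0 /=; ring.
Qed.

Lemma mul_binD2 p d : 'C(p + d.+2, d.+2) * (d.+2 * d.+1)
  = (p + d.+2) * (p + d.+1) * 'C(p + d, d).
Proof.
rewrite mulnA (mulnC 'C(_, _)) mul_binD -!mulnA; congr (_ * _).
by rewrite mulnC mul_binD.
Qed.

Lemma leq_binD k d : (0 < d)%N -> (k + 2 <= 'C(k + d + 1, d))%N.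
Proof.
move=> d_gt0; rewrite -bin_sub; last by lia.
have -> : (k + d + 1 - d = k.+1)%N by lia.
by rewrite addn2 -[leqLHS](binSn k.+1) leq_bin2l //; lia.
Qed.

(** Both sides are products over i <= j, and the comparison already holds factor
    by factor: a <= p ^ 2 / n <= p ^ 2 / i gives 1 + a / i <= (1 + p / i) ^ 2. *)
Lemma leq_bin_sqr n a p j : n * a <= p ^ 2 -> j <= n ->
  'C(a + j, j) <= 'C(p + j, j) ^ 2.
Proof.
move=> ap; elim: j => [|j IHj] jn; first by rewrite !addn0 !bin0.
have {}IHj := IHj (ltnW jn).
rewrite -(leq_pmul2l (m := j.+1 ^ 2)) // -expnMn mul_binD expnMn.
rewrite -[in leqLHS]mulnn -mulnA mul_binD mulnA leq_mul //.
rewrite !mulnDr -[in leqRHS]mulnn; nia.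
Qed.

(** The ratio 'C(k + d, d) / (k + 1), which is the increment of the first step of
    psi, does not decrease with k; evaluating it at a small k0 bounds it below. *)
Lemma bin_avg_leq d k0 k : 0 < d -> k0 <= k ->
  k.+1 * 'C(k0 + d, d) <= k0.+1 * 'C(k + d, d).
Proof.
move=> d_gt0; elim: k => [|k IHk]; first by rewrite leqn0 => /eqP ->.
rewrite leq_eqVlt => /predU1P[-> // | /IHk].
have := mul_binD d k; rewrite ![d + _]addnC -!bin_addC; nia.
Qed.

Lemma leq_bin_exp a n : 'C(a + n, n) <= a.+1 ^ n.
Proof.
elim: n => [|n IHn]; first by rewrite addn0 bin0.
rewrite -(leq_pmul2l (m := n.+1)) // mul_binD expnS mulnA leq_mul //; lia.
Qed.

(** Each factor (x + j) / j with 2 <= j <= n is at least b, and the factor for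
    j = 1 is x + 1. *)
Lemma geq_bin_exp x n b : 0 < n -> n * b <= x + n -> x.+1 * b ^ n.-1 <= 'C(x + n, n).
Proof.
elim: n => // -[|n] IHn _ nb; first by rewrite muln1 addn1 bin1.
rewrite -(leq_pmul2l (m := n.+2)) // mul_binD /= expnS.
rewrite [leqLHS](_ : _ = n.+2 * b * (x.+1 * b ^ n)); last by ring.
by rewrite leq_mul // IHn //; nia.
Qed.

Lemma bin3_ge_sqr c y : 6 * c < y -> c * y ^ 2 <= 'C(y + 1, 3).
Proof.
case: y => [|[|y]] //; first by case: c.
by rewrite addn1 => cy; have := bin3_mul6 y; nia.
Qed.

Lemma dvdn_factD d k : d`! %| (d + k)`!.
Proof.
by rewrite -(bin_fact (leq_addr k d)) mulnCA; apply: dvdn_mulr.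
Qed.

Lemma fact_div d k : ((d + k)`! %/ d`!) * d`! = (d + k)`!.
Proof. by rewrite divnK // dvdn_factD. Qed.

(** The factorial terms of Phi d k.+1 and phi d.+1 k have the same numerator. *)
Lemma fact_divS d k : (d + k.+1)`! %/ d`! = d.+1 * ((d.+1 + k)`! %/ d.+1`!).
Proof.
apply/eqP; rewrite -(eqn_pmul2r (fact_gt0 d)) fact_div mulnAC -factS mulnC.
by rewrite fact_div addnS.
Qed.

Lemma fact_div_gt0 d k : 0 < (d + k)`! %/ d`!.
Proof. by rewrite divn_gt0 ?fact_gt0 // dvdn_leq ?fact_gt0 // dvdn_factD. Qed.

Lemma fact_leq_exp n b : n <= b -> n`! <= b ^ n.
Proof.
elim: n => // n IHn nb; rewrite factS expnS leq_mul // IHn //; exact: ltnW.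
Qed.

Lemma pow_le_fact c n : exists s0, forall s, s0 <= s -> c * s ^ n <= s`!.
Proof.
elim: n c => [|n IHn] c.
  exists c.+1 => s cs; rewrite muln1 (leq_trans (ltnW cs)) //.
  by case: s cs => // s _; rewrite factS leq_pmulr ?fact_gt0.
have [s0 hs0] := IHn (c * 2 ^ n); exists s0.+2 => -[//|s] hs.
rewrite factS expnS mulnCA leq_mul //.
apply: leq_trans (hs0 s _); last by lia.
rewrite -mulnA leq_mul // -expnMn.
by case: (posnP n) => [-> // | n_gt0]; rewrite leq_exp2r //; lia.
Qed.

(** Bernoulli's inequality for (1 - 1/(s+1))^n, with denominators cleared. *)
Lemma bernoulli n s : n <= s -> (s.+1 - n) * s.+1 ^ n <= s.+1 * s ^ n.
Proof.
elim: n => [|n IHn] ns; first by rewrite subn0.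
have := IHn (ltnW ns); rewrite !expnS.
have : (s.+1 - n.+1) * s.+1 <= (s.+1 - n) * s by nia.
move: (s.+1 ^ n) (s ^ n) => A B; nia.
Qed.

(** One step from s to s + 1 needs (s + 1) ^ (n - 1) <= s ^ n, which follows from
    Bernoulli's inequality once s >= n. *)
Lemma pow_le_fact_from c n s0 s : 0 < n <= s0 -> c * s0 ^ n <= s0`! -> s0 <= s ->
  c * s ^ n <= s`!.
Proof.
move=> /andP[n0 ns0] hs0; elim: s => [|s IHs]; first by rewrite leqn0 => /eqP <-.
rewrite leq_eqVlt => /predU1P[<- // | lts].
have {}IHs := IHs lts; rewrite factS.
case: n n0 ns0 hs0 IHs => // n _ ns0 hs0 IHs.
rewrite expnS mulnCA leq_mul //; apply: leq_trans IHs.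
rewrite leq_mul // expnS.
have := @bernoulli n s; move: (s.+1 ^ n) (s ^ n) => A B; nia.
Qed.

(** * The functions vartheta, psi, phi and Phi *)

Lemma ceiln_div (a b : nat) : ceiln (a%:R / b.+1%:R)%R = (a + b) %/ b.+1.
Proof.
rewrite /ceiln (@ceil_def _ _ ((a + b) %/ b.+1)%:Z) ?absz_nat //.
have b0 : (0 < b.+1%:R :> rat)%R by rewrite ltr0n.
rewrite ler_pdivrMr // ltr_pdivlMr // !pmulrn -!intrM ltr_int ler_int; lia.
Qed.

Lemma vartheta_div d k : (0 < d)%N ->
  vartheta d k = (k + ('C(k + d + 1, d) - (k + 2) + k) %/ k.+1)%N.
Proof.
by move=> d_gt0; rewrite /vartheta (addn1 k) -natrB ?ceiln_div // leq_binD.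
Qed.

Lemma vartheta_ge d k : 0 < d -> k <= vartheta d k.
Proof. by move=> d_gt0; rewrite vartheta_div // leq_addr. Qed.

Lemma vartheta_le d k : 0 < d ->
  k.+1 * vartheta d k + 2 <= 'C(k + d + 1, d) + k.+1 * k.
Proof.
move=> d_gt0; have := leq_binD k d_gt0; rewrite vartheta_div //.
move: 'C(_, _) => B; have := leq_trunc_div (B - (k + 2) + k) k.+1; nia.
Qed.

(** For fixed d this is polynomial in k, hence eventually below the factorial. *)
Lemma vartheta_bin_le_pow d k : 1 < d ->
  'C((vartheta d k).+1 + d, d) <= (k + 2) ^ (d * d).
Proof.
move=> d_gt1; have d_gt0 : 0 < d by exact: ltnW.
apply: leq_trans (leq_bin_exp _ _) _.
rewrite expnM leq_exp2r // -addn2.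
have B_le : 'C(k + d + 1, d) <= (k + 2) ^ d.
  by rewrite -addnA (addnC d) addnA addn2 -(addn1 k) leq_bin_exp.
apply: leq_trans B_le; have := vartheta_le k d_gt0.
have : k + 3 <= 'C(k + d + 1, d).
  rewrite addnAC; apply: leq_trans (leq_binDr (k + 1) d_gt1).
  have := mul_binD (k + 1) 1; rewrite bin1; nia.
move: 'C(_, _) => B; nia.
Qed.

Lemma psiS d k i : (i <= d)%N ->
  psi d k i.+1 =
  (psi d k i + ('C(psi d k i + (d - i), d - i) + psi d k i) %/ (psi d k i).+1)%N.
Proof. by move=> id /=; rewrite addn1 mulrC ceiln_div addnBA. Qed.

Lemma psiS_ge d k i : i <= d ->
  'C(psi d k i + (d - i), d - i) + (psi d k i).+1 * psi d k i
    <= (psi d k i).+1 * psi d k i.+1.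
Proof.
move=> id; rewrite psiS //; move: (psi d k i) => p; move: 'C(_, _) => B.
have := ltn_ceil (B + p) (ltn0Sn p); nia.
Qed.

Lemma psi_leS d k i : i <= d -> psi d k i <= psi d k i.+1.
Proof. by move=> id; rewrite psiS ?leq_addr. Qed.

Lemma psi_homo d k i j : i <= j <= d -> psi d k i <= psi d k j.
Proof.
case/andP; elim: j => [|j IHj]; first by rewrite leqn0 => /eqP ->.
rewrite leq_eqVlt => /predU1P[-> // | ij] jd.
by apply: leq_trans (IHj ij (ltnW jd)) (psi_leS _ _); exact: ltnW.
Qed.

(** The dimension factors as (r + 1) r (r - 1) / 6; in this form it is visibly
    monotone in r, so that a partial iterate of psi bounds Phi from below. *)
Lemma dimM_cubicE r : dimM_cubic r = 'C(r + 1, 3).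
Proof.
case: r => [|[|r]] //; rewrite /dimM_cubic addn1 addn3.
by have := bin3_mul6 r.+2; have := bin3_mul6 r; nia.
Qed.

(** The two subtracted terms of dimM_intersection absorb d + k + 1, because
    vartheta d k >= k. *)
Lemma phi_le d k : 0 < d ->
  (phi d k <= (maxn ((d + k)`! %/ d`!) 'C((vartheta d k).+1 + d, d))%:Z)%R.
Proof.
move=> d_gt0; rewrite /phi /dimM_intersection.
have := vartheta_ge k d_gt0; move: (vartheta d k) => r kr.
rewrite ge_max; apply/andP; split; first by lia.
rewrite -addnA addn1 addnS -addSn.
by move: ((d + k)`! %/ d`!) 'C(_, _) => A B; nia.
Qed.

Lemma phi_ge d k : (((d + k)`! %/ d`!)%:Z <= phi d k)%R.
Proof. by rewrite /phi le_max lexx. Qed.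

Lemma phi_ge1 d k : (1 <= phi d k)%R.
Proof. by apply: le_trans (phi_ge d k); rewrite lez_nat fact_div_gt0. Qed.

Lemma phi_ge2 d k : 0 < d -> 0 < k -> (2 <= phi d k)%R.
Proof.
case: k => // k d_gt0 _; apply: le_trans (phi_ge d k.+1).
by rewrite lez_nat fact_divS (@leq_mul 2 1) // fact_div_gt0.
Qed.

(** Any iterate of psi may be used, as psi d k is nondecreasing up to d. *)
Lemma Phi_ge d k i : i <= d - 2 ->
  ((maxn ((d + k)`! %/ d`!) ('C(psi d k i + 1, 3) + (d + k + 1)))%:Z <= Phi d k)%R.
Proof.
move=> id; rewrite /Phi dimM_cubicE.
have : 'C(psi d k i + 1, 3) <= 'C(psi d k (d - 2) + 1, 3).
  by rewrite leq_bin2l // leq_add2r psi_homo // id leq_subr.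
move: (_ %/ _) => A; lia.
Qed.

(** * The geometric term of Phi against that of phi *)

(** The second inequality says that psi d k 1 is larger than the ratio, about
    (k + d + 1) (k + 1) / (k (d + 1)), between vartheta d.+1 k.-1 and psi d k 1, even
    after multiplication by d + 1. It fails for small parameters. When d is large the
    quadratic bound in d obtained at k0 = 2 suffices; when d is small, k is large and
    the values at k0 = 5 and k0 = 9 are used. *)
Lemma psi1_large d k : 4 < d -> 1 < k -> 15 < d + k ->
  33 <= psi d k 1 /\ (k + d + 1) * k.+1 <= k * psi d k 1.
Proof.
move=> d5 k2 dk; have d_gt0 : 0 < d by lia.
have := psiS_ge k (leq0n d); rewrite subn0 [psi d k 0]/=.
move: (psi d k 1) => p.
have := bin_avg_leq d_gt0 k2.
have B2 : 'C(2 + d, d) * 2 = (d + 1) * (d + 2).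
  have := bin_ffact (2 + d) 2; rewrite bin_addC !ffactnS ffactn0 (_ : 2`! = 2) //= => ->; ring.
have avg k0 : k0 <= k -> k.+1 * 'C(k0 + 5, 5) <= k0.+1 * 'C(k + d, d).
  move=> k0k; apply: leq_trans (bin_avg_leq (isT : 0 < 5) k0k) _.
  by rewrite leq_mul // leq_binDr.
have avg5 := avg 5; have avg9 := avg 9.
have E5 : 'C(5 + 5, 5) = 252 by [].
have E9 : 'C(9 + 5, 5) = 2002 by [].
rewrite {}E5 in avg5; rewrite {}E9 in avg9.
move: 'C(_, _) 'C(_, _) B2 avg5 avg9 => B C B2 avg5 avg9 BC pB.
have {BC} pd : 6 * k + (d + 1) * (d + 2) <= 6 * p by nia.
have p5 : 4 < k -> k + 42 <= p by move=> /avg5; nia.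
have p9 : 8 < k -> k + 200 <= p by move=> /avg9; nia.
split; first by nia.
have [d8|d8] := leqP 8 d; nia.
Qed.

(** Since 'C(k + d + 2, d + 1) = (k + d + 2) / (d + 1) * 'C(k + d + 1, d), the
    single step defining vartheta exceeds the first step of psi by a factor that is at
    most psi d k.+1 1 / (d + 1). The conclusion has the form needed by leq_bin_sqr. *)
Lemma vartheta_le_psi1 d k : 4 < d -> 0 < k -> 15 < d + k.+1 ->
  d.+1 * (vartheta d.+1 k).+1 <= psi d k.+1 1 ^ 2.
Proof.
move=> d5 k_gt0 dk; have [_] := psi1_large d5 (k_gt0 : 1 < k.+1) dk.
have := psiS_ge k.+1 (leq0n d); rewrite subn0 [psi d k.+1 0]/=.
have := vartheta_le k (ltn0Sn d); move: (psi d k.+1 1) (vartheta _ _) => p r.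
have -> : k + d.+1 + 1 = k.+1 + d.+1 by lia.
have := mul_binD k.+1 d; move: 'C(_, _) 'C(_, _) => B E EB rE Bp kp.
rewrite -(leq_pmul2l (m := k.+1)) //.
apply: (@leq_trans (k.+1 * d.+1 * k.+1 + (k.+1 + d.+1) * B)).
  rewrite -EB; have := leq_mul (leqnn d.+1) rE; lia.
apply: (@leq_trans ((k.+1 + d + 1) * k.+2 * p)).
  have := leq_mul (leqnn (k.+1 + d + 1)) Bp; lia.
by rewrite expnS expn1 mulnA leq_mul2r kp orbT.
Qed.

(** The heart of the comparison. Write p, x, y for the first three iterates of
    psi. The intersection term is at most (d + 1) 'C(p + d + 1, d + 1) ^ 2. Up to a
    quadratic factor in p, that binomial is 'C(p + d - 1, d - 1) <= (p + 1) x; as x is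
    at least cubic in p, the product is O(x ^ 4). On the other side y >= x ^ 2 / 6 and
    the cubic term grows like y ^ 3, i.e. like x ^ 6. *)
Lemma cubic_ge_intersection d k : 4 < d -> 0 < k -> 15 < d + k.+1 ->
  d.+1 * 'C((vartheta d.+1 k).+1 + d.+1, d.+1) <= 'C(psi d k.+1 3 + 1, 3).
Proof.
move=> d5 k_gt0 dk.
have [p33 kp] := psi1_large d5 (k_gt0 : 1 < k.+1) dk.
have := leq_bin_sqr (vartheta_le_psi1 d5 k_gt0 dk) (leqnn _).
have d2 : 2 <= d by lia. have d1 : 1 <= d by lia.
have := psiS_ge k.+1 d1; have := psiS_ge k.+1 d2.
move: (psi d k.+1 1) (psi d k.+1 2) (psi d k.+1 3) p33 kp => p x y.
move: 'C(_.+1 + _, _) => T p33 kp.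
have pd : d + 1 <= p by nia.
have B4 : 'C(p + 4, 4) <= 'C(p + (d - 1), d - 1) by apply: leq_binDr; lia.
have B3 : 'C(x + 3, 3) <= 'C(x + (d - 2), d - 2) by apply: leq_binDr; lia.
have := mul_binD2 p d.-1; have -> : d.-1.+2 = d.+1 by lia.
have -> : d.-1.+1 = d by lia.
rewrite -subn1.
have := bin4_mul24 p; have := bin3_mul6 x; rewrite -(addn3 x).
move: 'C(p + 4, 4) 'C(x + 3, 3) 'C(p + (d - 1), _) 'C(_, d - 2) 'C(p + d.+1, _) B4 B3.
move=> C4 C3 B B' E C4B C3B' C3E C4E EB xB yB TE.
have px : (p + 4) * (p + 3) * (p + 2) <= 24 * x.
  rewrite -(leq_pmul2r (m := p + 1)) ?addn1 //; lia.
have xy : (x + 3) * (x + 2) <= 6 * y.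
  rewrite -(leq_pmul2r (m := x + 1)) ?addn1 //; lia.
(* Enough for y > 6 * 2232, where 2232 = 62 * 36: the intersection term is at most
   62 x ^ 4 (as 96 * 96 <= 62 * 150) and x ^ 4 <= 36 y ^ 2. *)
have x_ge : 300 <= x.
  have := leq_mul p33 (leq_mul p33 p33); lia.
have y_ge : 6 * 2232 < y by have := leq_mul x_ge x_ge; lia.
have Ex : E * (d.+1 * d) <= 96 * x ^ 2.
  have pp : (p + d.+1) * (p + d) <= 4 * p ^ 2.
    by have := @leq_mul (p + d.+1) (p + d) (2 * p) (2 * p); lia.
  have Bx : B <= p.+1 * x by lia.
  rewrite EB; apply: leq_trans (leq_mul pp Bx) _.
  have ppp : p ^ 2 * p.+1 <= 24 * x by lia.
  have := leq_mul ppp (leqnn x); lia.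
have Ex1 : 5 * (d.+1 * E) <= 96 * x ^ 2.
  by apply: leq_trans Ex; rewrite mulnC [d.+1 * E]mulnC -mulnA !leq_mul.
have Ex2 : 30 * E <= 96 * x ^ 2.
  by apply: leq_trans Ex; rewrite mulnC leq_mul // (@leq_mul 6 5).
have Ex4 : 150 * (d.+1 * E ^ 2) <= 96 * 96 * x ^ 4.
  have := leq_mul Ex1 Ex2; lia.
apply: leq_trans (@bin3_ge_sqr 2232 y _) => //.
have y2 : x ^ 4 <= 36 * y ^ 2.
  have x2 : x ^ 2 <= 6 * y by lia.
  have := leq_mul x2 x2; lia.
have := leq_mul (leqnn d.+1) TE; lia.
Qed.

(** The factorial terms are in ratio exactly d + 1, as d + k is the same on both
    sides, and the geometric terms in ratio at least d + 1. *)
Lemma Phi_ge_phiS d k : 4 < d -> 0 < k -> 15 < d + k.+1 ->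
  (d.+1%:Z * phi d.+1 k <= Phi d k.+1)%R.
Proof.
move=> d5 k_gt0 dk.
have d3 : 3 <= d - 2 by lia.
apply: le_trans (Phi_ge k.+1 d3).
apply: le_trans (ler_wpM2l _ (phi_le k (ltn0Sn d))) _ => //.
have := cubic_ge_intersection d5 k_gt0 dk.
rewrite -PoszM lez_nat fact_divS maxnMr; lia.
Qed.

(** For k = 1 the index d cannot be increased, but three iterates of psi already
    exceed the whole factorial: the second is quadratic in d, so the third is at least
    (d + 1) ^ (d - 3), and the cubic term at least the square of that. *)
Lemma fact_le_cubic d : 14 < d -> d.+1`! <= 'C(psi d 1 3 + 1, 3).
Proof.
move=> d15; have [d1 d2] : 1 <= d /\ 2 <= d by lia.
have := psiS_ge 1 (leq0n d); rewrite subn0 [psi d 1 0]/= bin_addC bin1.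
have := psiS_ge 1 d1; have := psiS_ge 1 d2.
move: (psi d 1 1) (psi d 1 2) (psi d 1 3) => p x y.
have [x0 | x_lt] := leqP (d.+1 * (d - 2)) x; last first.
  have d1_gt0 : 0 < d - 1 by lia.
  move=> _ Bx pd; have p4 : 4 <= p by lia.
  have := bin_avg_leq d1_gt0 p4; rewrite bin_addC (addnC 4).
  move: 'C(p + _, _) Bx => B Bx avg.
  have {avg Bx B} : 'C(d - 1 + 4, 4) <= 5 * x.
    by rewrite -(leq_pmul2l (ltn0Sn p)); lia.
  have := bin4_mul24 (d - 1); move: 'C(_, _) => B B4 Bx.
  suff : d.+1 * (d - 2) <= x by rewrite leqNgt x_lt.
  have d23 : 306 <= d.+2 * d.+3 by rewrite (@leq_mul 17 18) //; lia.
  have := leq_mul d23 (leqnn (d.+1 * d)); nia.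
move=> By _ _.
have n_gt0 : 0 < d - 2 by lia.
have : (d - 2) * d.+1 <= x + (d - 2) by lia.
move=> /(geq_bin_exp n_gt0) => Bb.
have y_ge : d.+1 ^ (d - 2).-1 <= y.
  rewrite -(leq_pmul2l (ltn0Sn x)); lia.
have y6 : 6 * 1 < y.
  apply: leq_trans y_ge; apply: (@leq_trans (d.+1 ^ 1)); first by lia.
  by rewrite leq_pexp2l //; lia.
apply: leq_trans (bin3_ge_sqr y6); rewrite mul1n.
apply: leq_trans (leq_mul y_ge y_ge); rewrite -expnD.
apply: leq_trans (fact_leq_exp (leqnn _)) _.
by rewrite leq_pexp2l //; lia.
Qed.

(** * The minima *)

Local Open Scope ring_scope.

Definition minPhi m : int :=
  \big[Num.min/Phi 2 (m - 2 - 1)]_(2 <= d < (m - 2).+1) Phi d (m - d - 1).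

Lemma floor_half (x : int) : Num.floor (x%:~R / 2 : rat) = (x %/ 2)%Z.
Proof.
apply: floor_def; rewrite ler_pdivlMr // ltr_pdivrMr // !pmulrn -!intrM.
by rewrite ltr_int ler_int; lia.
Qed.

Lemma F_minPhi m : (3 < m)%N -> F m = 2 * (minPhi m %/ 2)%Z + 1.
Proof. by rewrite /F ltnNge => /negPf ->; rewrite floor_half. Qed.

Lemma minPhi_ge m T : (3 < m)%N ->
  (forall d, (1 < d)%N -> (d < m - 1)%N -> T <= Phi d (m - d - 1)) -> T <= minPhi m.
Proof.
move=> m4 hT; rewrite /minPhi big_nat_cond; apply: le_bigmin; first by apply: hT; lia.
by move=> d /andP[/andP[d2 dm] _]; apply: hT; lia.
Qed.

Lemma minPhi_le m d : (1 < d < m - 1)%N -> minPhi m <= Phi d (m - d - 1).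
Proof. by move=> dm; apply: ge_bigmin_seq; rewrite // mem_index_iota; lia. Qed.

Lemma F_ge m T : (3 < m)%N ->
  (forall d, (1 < d)%N -> (d < m - 1)%N -> T <= Phi d (m - d - 1)) -> T <= F m.
Proof. by move=> m4 /(minPhi_ge m4); rewrite F_minPhi //; lia. Qed.

Lemma G_le m d : (14 < m)%N -> (3 < d < m - 1)%N -> G m <= 1 + phi d (m - d - 1).
Proof.
rewrite /G ltnNge => /negPf -> dm; rewrite lerD2l.
by apply: ge_bigmin_seq; rewrite // mem_index_iota; lia.
Qed.

Lemma G_ge m T : (14 < m)%N ->
  (forall d, (3 < d)%N -> (d < m - 1)%N -> T <= phi d (m - d - 1)) -> 1 + T <= G m.
Proof.
move=> m15 hT; rewrite /G leqNgt m15 /= lerD2l big_nat_cond.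
apply: le_bigmin; first by apply: hT; lia.
by move=> d /andP[/andP[d4 dm] _]; apply: hT; lia.
Qed.

Lemma G_gt2 m : (14 < m)%N -> 2 < G m.
Proof.
move=> m15; apply: lt_le_trans (G_ge (T := 2) m15 _) => // d d4 dm.
by apply: phi_ge2; lia.
Qed.

Lemma Phi_ge_fact_anti s d D : (d <= D)%N -> (D <= s)%N ->
  ((s`! %/ D`!)%N%:Z <= Phi d (s - d)).
Proof.
move=> dD Ds; apply: le_trans (Phi_ge (s - d) (leq0n (d - 2))).
rewrite subnKC ?(leq_trans dD) // lez_nat leq_max; apply/orP; left.
by rewrite leq_div2l ?fact_gt0 ?leq_fact.
Qed.

(** Every index d of the minimum in F is matched with an index of the minimum in
    G: d with D when d < D, by the factorial term alone; d with d + 1 when d >= D and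
    k > 1; and d with D again when k = 1, as d + 1 is then out of range; there Phi exceeds
    the full factorial. *)
Lemma G_F_gap c D m : (4 < D)%N -> (16 < m)%N -> (D < m - 1)%N -> (c <= D)%N ->
  c%:Z * phi D (m - D - 1) <= ((m - 1)`! %/ (D - 1)`!)%N%:Z ->
  c%:Z * (G m - 1) <= F m.
Proof.
move=> D5 m17 Dm cD hD; apply: F_ge => [|d d2 dm]; first by lia.
have G_phi e : (3 < e < m - 1)%N -> G m - 1 <= phi e (m - e - 1).
  by move=> em; rewrite lerBlDl G_le //; lia.
have c_ge0 : 0 <= c%:Z by [].
have cG : c%:Z * (G m - 1) <= ((m - 1)`! %/ (D - 1)`!)%N%:Z.
  by apply: le_trans hD; rewrite ler_wpM2l // G_phi //; lia.
have -> : (m - d - 1 = m - 1 - d)%N by lia.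
have [dD | Dd] := ltnP d D.
  by apply: le_trans cG _; apply: Phi_ge_fact_anti; lia.
have [k1 | k_ne1] := eqVneq (m - 1 - d)%N 1%N.
  have d3 : (3 <= d - 2)%N by lia.
  apply: le_trans cG _; rewrite k1; apply: le_trans (Phi_ge 1 d3).
  rewrite lez_nat leq_max; apply/orP; right.
  apply: leq_trans (leq_div _ _) _.
  have -> : (m - 1 = d.+1)%N by lia.
  apply: leq_trans (fact_le_cubic _) (leq_addr _ _); lia.
have [k dk k_gt0] : exists2 k, (m - 1 - d)%N = k.+1 & (0 < k)%N.
  by exists (m - 2 - d)%N; lia.
rewrite dk; apply: le_trans (Phi_ge_phiS _ k_gt0 _); [|lia|lia].
have : G m - 1 <= phi d.+1 k.
  have -> : k = (m - d.+1 - 1)%N by lia.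
  by apply: G_phi; lia.
have := phi_ge1 d.+1 k; nia.
Qed.

(** * Evaluation in binary arithmetic *)

(** Binary counterparts of the functions above, for evaluation by the kernel. *)
Fixpoint factN (n : nat) : N :=
  if n is m.+1 then (bin_of_nat n * factN m)%num else 1%num.

Fixpoint ffactN (n : N) (r : nat) : N :=
  if r is s.+1 then (n * ffactN (N.pred n) s)%num else 1%num.

Definition binN (n : N) (r : nat) : N := N.div (ffactN n r) (factN r).

Definition varthetaN (d k : nat) : N :=
  let kN := bin_of_nat k in
  (kN + N.div (binN (bin_of_nat (k + d + 1)) d - (kN + 2) + kN) (N.succ kN))%num.

Fixpoint psiN (d k i : nat) : N :=
  if i is j.+1 then
    let p := psiN d k j in
    (p + N.div (binN (p + bin_of_nat (d - j)) (d - j) + p) (N.succ p))%num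
  else bin_of_nat k.

Lemma nat_of_binD a b : nat_of_bin (a + b)%num = (nat_of_bin a + nat_of_bin b)%N.
Proof. lia. Qed.

Lemma nat_of_binM a b : nat_of_bin (a * b)%num = (nat_of_bin a * nat_of_bin b)%N.
Proof. lia. Qed.

Lemma nat_of_binX a n : nat_of_bin (iter n (N.mul a) 1%num) = (nat_of_bin a ^ n)%N.
Proof. by elim: n => // n IHn; rewrite iterS nat_of_binM IHn expnS. Qed.

Lemma Ndiv_divn a b : nat_of_bin (N.div a b) = (nat_of_bin a %/ nat_of_bin b)%N.
Proof.
case: (N.eq_dec b 0%num) => [-> | b0]; first by rewrite divn0; case: a.
have := N.div_mod a b b0; have := N.mod_lt a b b0.
move: (N.div a b) (N.modulo a b) => q r ltrb ->.
have [-> rb] : (nat_of_bin (b * q + r)%num = q * b + r)%N /\ (r < b)%N by lia.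
by rewrite divnMDl ?divn_small ?addn0 //; lia.
Qed.

Lemma factNE n : nat_of_bin (factN n) = n`!.
Proof.
elim: n => // n IHn.
by rewrite -[factN _]/(bin_of_nat n.+1 * factN n)%num nat_of_binM bin_of_natK IHn.
Qed.

Lemma ffactNE n r : nat_of_bin (ffactN n r) = nat_of_bin n ^_ r.
Proof.
elim: r n => // r IHr n /=; rewrite nat_of_binM IHr ffactnS.
by congr (_ * _ ^_ _)%N; lia.
Qed.

Lemma binNE n r : nat_of_bin (binN n r) = 'C(nat_of_bin n, r).
Proof. by rewrite Ndiv_divn ffactNE factNE bin_ffactd. Qed.

Lemma varthetaNE d k : (0 < d)%N -> nat_of_bin (varthetaN d k) = vartheta d k.
Proof.
move=> d_gt0; rewrite vartheta_div // nat_of_binD Ndiv_divn bin_of_natK.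
have := binNE (bin_of_nat (k + d + 1)) d; rewrite bin_of_natK.
have := bin_of_natK k; move: (binN _ _) (bin_of_nat k) 'C(_, _) => B K C KE BE.
by congr (_ + _ %/ _)%N; lia.
Qed.

Lemma psiNE d k i : (i <= d)%N -> nat_of_bin (psiN d k i) = psi d k i.
Proof.
elim: i => [|i IHi] id; first exact: bin_of_natK.
have {}IHi := IHi (ltnW id).
rewrite psiS ?(ltnW id) //= nat_of_binD Ndiv_divn nat_of_binD binNE.
rewrite nat_of_binD bin_of_natK IHi.
by congr (_ + _ %/ _)%N; rewrite -IHi; lia.
Qed.

(** The iterates of psi explode, so the search stops at the first one that passes
    the threshold T. The conditionals, unlike boolean connectives, keep the virtual
    machine from evaluating the later iterates. *)
Fixpoint cubic_search (T : N) (d k fuel i : nat) : bool :=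
  if fuel is f.+1 then
    if N.leb T (binN (psiN d k i + 1) 3 + bin_of_nat (d + k + 1)) then true
    else cubic_search T d k f i.+1
  else false.

Lemma cubic_searchP T d k fuel i : (fuel + i <= (d - 2).+1)%N ->
  cubic_search T d k fuel i -> (nat_of_bin T)%:Z <= Phi d k.
Proof.
elim: fuel i => // f IHf i fi /=.
case: ifP => [hT _ | _]; last by apply: IHf; lia.
have id : (i <= d - 2)%N by lia.
apply: le_trans (Phi_ge k id); rewrite lez_nat leq_max; apply/orP; right.
have := binNE (psiN d k i + 1) 3; have := bin_of_natK (d + k + 1).
rewrite nat_of_binD psiNE; last by lia.
by move: (binN _ _) (bin_of_nat _) 'C(_, _) hT => B K C; lia.
Qed.

Definition Phi_geb (T : N) (d k : nat) : bool :=
  if N.leb T (factN (d + k) / factN d) then true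
  else cubic_search T d k (d - 2).+1 0.

Lemma Phi_gebP T d k : Phi_geb T d k -> (nat_of_bin T)%:Z <= Phi d k.
Proof.
rewrite /Phi_geb; case: ifP => [hT _ | _].
  apply: le_trans (Phi_ge k (leq0n (d - 2))); rewrite lez_nat leq_max -!factNE.
  by rewrite -Ndiv_divn; apply/orP; left; lia.
by apply: cubic_searchP; rewrite addn0.
Qed.

Definition Phi_leb (T : N) (d k : nat) : bool :=
  N.leb (factN (d + k) / factN d) T &&
  N.leb (binN (psiN d k (d - 2) + 1) 3 + bin_of_nat (d + k + 1)) T.

Lemma Phi_lebP T d k : Phi_leb T d k -> Phi d k <= (nat_of_bin T)%:Z.
Proof.
case/andP=> h1 h2; rewrite /Phi dimM_cubicE ge_max -!factNE -Ndiv_divn.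
apply/andP; split; first by lia.
have := binNE (psiN d k (d - 2) + 1) 3; have := bin_of_natK (d + k + 1).
rewrite nat_of_binD psiNE ?leq_subr //.
by move: (binN _ _) (bin_of_nat _) 'C(_, _) h2 => B K C; lia.
Qed.

Definition phi_geb (T : N) (d k : nat) : bool :=
  if N.leb T (factN (d + k) / factN d) then true
  else let r := varthetaN d k in
    N.leb (T + ((r + 1) * (r + 1) + r))
          (binN (r + bin_of_nat (d + 1)) d + bin_of_nat (k + 1)).

Lemma phi_gebP T d k : (0 < d)%N -> phi_geb T d k -> (nat_of_bin T)%:Z <= phi d k.
Proof.
move=> d_gt0; rewrite /phi_geb; case: ifP => [hT _ | _].
  apply: le_trans (phi_ge d k); rewrite lez_nat -!factNE -Ndiv_divn; lia.
rewrite /phi /dimM_intersection le_max => hT; apply/orP; right.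
have := binNE (varthetaN d k + bin_of_nat (d + 1)) d; move: hT.
rewrite -(varthetaNE k d_gt0) nat_of_binD !bin_of_natK addnA.
move: (bin_of_natK (k + 1)).
move: (varthetaN d k) (binN _ _) (bin_of_nat (k + 1)) 'C(_, _) => r B K C; lia.
Qed.

Definition phi_leb (T : N) (d k : nat) : bool :=
  N.leb (factN (d + k) / factN d) T &&
  N.leb (binN (N.succ (varthetaN d k) + bin_of_nat d) d) T.

Lemma phi_lebP T d k : (0 < d)%N -> phi_leb T d k -> phi d k <= (nat_of_bin T)%:Z.
Proof.
move=> d_gt0 /andP[h1 h2]; apply: le_trans (phi_le k d_gt0) _.
rewrite lez_nat geq_max -!factNE -Ndiv_divn; apply/andP; split; first by lia.
have -> : (vartheta d k).+1 = nat_of_bin (N.succ (varthetaN d k)).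
  by rewrite -varthetaNE //; lia.
have := binNE (N.succ (varthetaN d k) + bin_of_nat d) d.
by rewrite nat_of_binD bin_of_natK => <-; lia.
Qed.

Lemma minPhi_geN T m : (3 < m)%N ->
  all (fun d => Phi_geb T d (m - d - 1)) (iota 2 (m - 3)) ->
  (nat_of_bin T)%:Z <= minPhi m.
Proof.
move=> m4 /allP h; apply: minPhi_ge => // d d2 dm.
by apply/Phi_gebP/h; rewrite mem_iota; lia.
Qed.

Lemma F_eqN T m d : (1 < d < m - 1)%N ->
  all (fun d => Phi_geb T d (m - d - 1)) (iota 2 (m - 3)) ->
  Phi_leb T d (m - d - 1) -> F m = 2 * ((nat_of_bin T)%:Z %/ 2)%Z + 1.
Proof.
move=> dm hge hle; have m4 : (3 < m)%N by lia.
rewrite F_minPhi //; congr (2 * (_ %/ _)%Z + 1).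
by have := minPhi_geN m4 hge; have := minPhi_le dm; have := Phi_lebP hle; lia.
Qed.

Lemma F_gtN T m : (3 < m)%N ->
  all (fun d => Phi_geb T d (m - d - 1)) (iota 2 (m - 3)) -> (nat_of_bin T)%:Z <= F m.
Proof. by move=> m4 /(minPhi_geN m4); rewrite F_minPhi //; lia. Qed.

Lemma G_eqN T m d : (14 < m)%N -> (3 < d < m - 1)%N ->
  all (fun d => phi_geb T d (m - d - 1)) (iota 4 (m - 5)) ->
  phi_leb T d (m - d - 1) -> G m = 1 + (nat_of_bin T)%:Z.
Proof.
move=> m15 dm /allP hge hle; apply/eqP; rewrite eq_le; apply/andP; split.
  by apply: le_trans (G_le m15 dm) _; rewrite lerD2l phi_lebP //; lia.
apply: G_ge => // e e4 em; apply: phi_gebP; first by lia.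
by apply: hge; rewrite mem_iota; lia.
Qed.

(** The common minimum must be even for the rounding in F to give the value of G. *)
Lemma G_eq_FN t m d : (14 < m)%N -> (3 < d < m - 1)%N ->
  all (fun d => phi_geb (2 * t) d (m - d - 1)) (iota 4 (m - 5)) ->
  phi_leb (2 * t) d (m - d - 1) ->
  all (fun d => Phi_geb (2 * t) d (m - d - 1)) (iota 2 (m - 3)) ->
  Phi_leb (2 * t) d (m - d - 1) -> G m = F m.
Proof.
move=> m15 dm g1 g2 f1 f2; rewrite (G_eqN m15 dm g1 g2) (F_eqN _ f1 f2); last by lia.
by rewrite nat_of_binM; lia.
Qed.

Lemma G_eq_F_small m : m \in [:: 1; 2; 3; 4; 5; 15; 16]%N -> G m = F m.
Proof.
have F4 : F 4 = 2 * ((nat_of_bin 4)%:Z %/ 2)%Z + 1.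
  by apply: (@F_eqN 4 4 2); vm_compute.
have F5 : F 5 = 2 * ((nat_of_bin 9)%:Z %/ 2)%Z + 1.
  by apply: (@F_eqN 9 5 3); vm_compute.
have GF15 : G 15 = F 15 by apply: (@G_eq_FN 1816214400 15 4); vm_compute.
have GF16 : G 16 = F 16 by apply: (@G_eq_FN 27243216000 16 4); vm_compute.
rewrite !inE => /or4P[/eqP->|/eqP->|/eqP->|] //.
by case/or4P => /eqP->; rewrite ?F4 ?F5.
Qed.

Lemma G_lt_F_small m : (5 < m < 15)%N -> G m < F m.
Proof.
have hN : all (fun m => all
    (fun d => Phi_geb (nth 0%num G_init m.-1 + 1)%num d (m - d - 1)) (iota 2 (m - 3)))
  (iota 6 9) by vm_compute.
move=> mlt; have m4 : (3 < m)%N by lia.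
have /(allP hN) : m \in iota 6 9 by rewrite mem_iota; lia.
move=> /(F_gtN m4); rewrite /G (_ : (m <= 14)%N = true); last by lia.
by rewrite nat_of_binD; lia.
Qed.

(** * The range m >= 17 and the limit *)

Lemma pow_le_factN c b n m : N.leb (c * iter n (N.mul b) 1%num) (factN m) ->
  (nat_of_bin c * nat_of_bin b ^ n <= m`!)%N.
Proof.
by rewrite -nat_of_binX -factNE; move: (iter _ _ _) (factN _) => X f; lia.
Qed.

(** From k = 31 on, the polynomial bound of degree 25 is below the factorial; the
    smaller values are computed exactly. *)
Lemma phi5_bin_le k : (10 < k)%N ->
  (48 * 'C((vartheta 5 k).+1 + 5, 5) <= (5 + k)`!)%N.
Proof.
move=> k_gt; have [k_lt | k_ge] := ltnP k 31.
  have hN : all (fun k =>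
      N.leb (48 * binN (N.succ (varthetaN 5 k) + 5) 5) (factN (5 + k))) (iota 11 20).
    by vm_compute.
  have /(allP hN) : k \in iota 11 20 by rewrite mem_iota; lia.
  have := binNE (N.succ (varthetaN 5 k) + 5) 5; have := factNE (5 + k).
  rewrite nat_of_binD -(varthetaNE k (isT : (0 < 5)%N)).
  have -> : nat_of_bin (N.succ (varthetaN 5 k)) = (nat_of_bin (varthetaN 5 k)).+1 by lia.
  move: (binN _ _) (factN _) (_`!)%N => B f A <-; move: 'C(_, _) => C; lia.
(* 36 is the first s with 48 s ^ 25 <= s!. *)
apply: (@leq_trans (48 * (5 + k) ^ 25)%N).
  rewrite leq_mul //; apply: leq_trans (vartheta_bin_le_pow k (isT : (1 < 5)%N)) _.
  by rewrite leq_exp2r //; lia.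
apply: (@pow_le_fact_from 48 25 36) (isT) _ _; last by lia.
by apply: (@pow_le_factN 48 36 25 36); vm_compute.
Qed.

(** The hypothesis of G_F_gap for c = 2 and D = 5; it fails at m = 16, where G and
    F agree. *)
Lemma two_phi5_le m : (16 < m)%N ->
  2 * phi 5 (m - 5 - 1) <= ((m - 1)`! %/ (5 - 1)`!)%N%:Z.
Proof.
move=> m17; have [k mk k_gt] : exists2 k, m = (5 + k).+1 & (10 < k)%N.
  by exists (m - 6)%N; lia.
have -> : (m - 5 - 1 = k)%N by lia.
have -> : (m - 1 = 5 + k)%N by lia.
have := phi_le k (isT : (0 < 5)%N); have := phi5_bin_le k_gt.
have -> : (48 = 2 * 4`!)%N by [].
have := fact_divS 4 k; rewrite -[(4 + k.+1)%N]/(5 + k)%N.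
rewrite mulnAC -leq_divRL ?fact_gt0 ?(dvdn_factD 4 k.+1) // => E.
rewrite -[(5 - 1)%N]/4%N {}E.
by move: (_ %/ _)%N 'C(_, _) => A C; lia.
Qed.

Lemma G_lt_F_large m : (16 < m)%N -> G m < F m.
Proof.
move=> m17; have D_lt : (5 < m - 1)%N by lia.
have m15 : (14 < m)%N by lia.
have := @G_F_gap 2 5 m isT m17 D_lt isT (two_phi5_le m17).
by have := G_gt2 m15; lia.
Qed.

(** The factorial term satisfies this with equality; the geometric term is
    polynomial in m for fixed D. *)
Lemma mul_phi_le_eventually D : (1 < D)%N -> exists m0, forall m, (m0 <= m)%N ->
  D%:Z * phi D (m - D - 1) <= ((m - 1)`! %/ (D - 1)`!)%N%:Z.
Proof.
case: D => [|[|D]] // _; have [s0 hs0] := pow_le_fact D.+2`! (D.+2 * D.+2).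
exists (s0 + D.+4)%N => m hm.
have [k mk] : exists k, m = (D.+2 + k.+1)%N by exists (m - D.+3)%N; lia.
have -> : (m - D.+2 - 1 = k)%N by lia.
have -> : (m - 1 = D.+1 + k.+1)%N by lia.
rewrite subn1 fact_divS PoszM ler_wpM2l //.
apply: le_trans (phi_le k (ltn0Sn _)) _; rewrite lez_nat geq_max leqnn /=.
rewrite leq_divRL ?fact_gt0 ?dvdn_factD // mulnC.
apply: leq_trans (hs0 _ _); last by lia.
rewrite leq_mul //; apply: leq_trans (vartheta_bin_le_pow k (isT : (1 < D.+2)%N)) _.
by rewrite leq_exp2r //; lia.
Qed.

Lemma F_ge_mul_G D : (4 < D)%N -> exists m0, forall m, (m0 <= m)%N ->
  2 < G m /\ D%:Z * (G m - 1) <= F m.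
Proof.
move=> D5; have [m0 hm0] := mul_phi_le_eventually (ltn_trans (isT : (1 < 4)%N) D5).
exists (m0 + D + 17)%N => m hm; split; first by apply: G_gt2; lia.
by apply: (G_F_gap D5) => //; [lia|lia|apply: hm0; lia].
Qed.

Local Open Scope classical_set_scope.
Local Open Scope ring_scope.

Theorem theorem4p1 :
  (forall m : nat, (1 <= m)%N ->
     G m <= F m /\
     (G m = F m <-> m \in [:: 1; 2; 3; 4; 5; 15; 16]%N)) /\
  (forall R : realType,
     ((F m)%:~R / (G m)%:~R : R) @[m --> \oo] --> +oo).
Proof.
split=> [m m_gt0 | R].
  have [mS | mNS] := boolP (m \in [:: 1; 2; 3; 4; 5; 15; 16]%N).
    by rewrite (G_eq_F_small mS).
  have GF : G m < F m.
    have [m17 | m16] := ltnP 16 m; first exact: G_lt_F_large.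
    by apply: G_lt_F_small; move: mNS; rewrite !inE; lia.
  by split; [exact: ltW | split=> // GFm; move: GF; rewrite GFm ltxx].
apply/cvgryPge => A.
pose D := (`|Num.ceil (A * 2)| + 5)%N.
have AD : A * 2 <= D%:R.
  apply: le_trans (Num.Theory.ceil_ge _) _.
  by rewrite (pmulrn _ D) ler_int /D; move: (Num.ceil _) => z; lia.
have [|m0 hm0] := @F_ge_mul_G D; first by rewrite /D; lia.
exists m0 => // m /= /hm0[G_gt FG].
have Gpos : 0 < (G m)%:~R :> R by rewrite ltr0z; lia.
(* D >= 2 A makes up for the loss in G m - 1 >= G m / 2. *)
rewrite ler_pdivlMr // -(ler_pM2l (ltr0n R 2)).
apply: (@le_trans _ _ (D%:R * (G m)%:~R)).
  by rewrite mulrA [2 * A]mulrC ler_wpM2r // ltW.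
rewrite (pmulrn _ 2) (pmulrn _ D) -!intrM ler_int; nia.
Qed.
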